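(* Let $\alpha\in(0,2)$, let $1\le K<N$ be integers, let $x_1,\dots,x_N\in[0,1)$ be distinct nodes and $w_i=\frac{(1-x_i^2)^{\alpha/2}}{N}$, $1\le i\le N$. For a real polynomial $f$ put $$I(f)=\int_0^1 f(r)(1-r^2)^{\alpha/2}\,dr,\qquad I_w(f)=\sum_{i=1}^N f(x_i)w_i .$$ Let $\{\lambda_i\}_{i=1}^K$ and $\{s_i\}_{i=1}^K$ be the nodes and weights produced by $K$ Lanczos iterations from $(x_i,w_i)_{i=1}^N$ (as described in the context), and put $I_s(f)=\sum_{i=1}^K f(\lambda_i)s_i$. Let $\varepsilon\ge0$. Then for every real polynomial $f$ of degree at most $2K-1$ with $|I(f)-I_w(f)|\le\varepsilon$ one has $$I_s(f)=I_w(f)\qquad\text{and therefore}\qquad |I(f)-I_s(f)|\le\varepsilon .$$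
   Context: Construction of the nodes and weights. Let $A=\mathrm{diag}(x_1,\dots,x_N)\in\mathbb{R}^{N\times N}$ and $b=(\sqrt{w_1},\dots,\sqrt{w_N})^T\in\mathbb{R}^N$, so that $I_w(f)=b^Tf(A)b$. Run the Lanczos process (in exact arithmetic) on $A$ with starting vector $b$ for $K$ iterations: this yields $Q_K\in\mathbb{R}^{N\times K}$ with $Q_K^TQ_K=\mathrm{Id}$, whose first column is $b/\|b\|$ and whose first $j$ columns span the Krylov space $\mathrm{span}\{b,Ab,\dots,A^{j-1}b\}$ for each $j\le K$, and the symmetric tridiagonal matrix $T_K=Q_K^TAQ_K\in\mathbb{R}^{K\times K}$. Take an eigendecomposition $T_K=V\Lambda V^T$ with $V$ orthogonal and $\Lambda=\mathrm{diag}(\lambda_1,\dots,\lambda_K)$, and set $C=Q_KV$. The new nodes are $\lambda_1,\dots,\lambda_K$ and the new weights are $s_i=\big((C^Tb)_i\big)^2$, so that $I_s(f)=b^TCf(\Lambda)C^Tb$. The initial rule $(x_i,w_i)$ is a simple rule such as the midpoint rule $x_i=(i-\frac12)/N$ with $N$ large. *)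

(* Defs.v *)
From HB Require Import structures.
From mathcomp Require Import all_boot all_order all_algebra.
From mathcomp Require Import all_classical all_reals all_analysis.

Set Implicit Arguments.
Unset Strict Implicit.
Unset Printing Implicit Defensive.

Import Order.TTheory GRing.Theory Num.Theory.

Local Open Scope ring_scope.

Definition dotv (R : realType) (n : nat) (u v : 'cV[R]_n) : R :=
  (u^T *m v) 0 0.

(* The norm `|v| that the library puts on matrices is the sup norm. *)
Definition norm2 (R : realType) (n : nat) (v : 'cV[R]_n) : R :=
  Num.sqrt (dotv v v).

(* State of the Lanczos process after j steps (columns numbered from 0):
   (q_(j-1), beta_(j-1), q_j), where beta_(j-1) is the coefficient coupling
   q_(j-1) to q_j, q_(-1) = 0 and beta_(-1) = 0.  One step computes
     u         = A q_j - beta_(j-1) q_(j-1),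
     r         = u - <q_j, u> q_j,
     beta_j    = ||r||,
     q_(j+1)   = r / beta_j.
   At a breakdown (beta_j = 0) the convention 0^-1 = 0 makes q_(j+1) = 0. *)
Definition lanczos_step (R : realType) (n : nat) (A : 'M[R]_n)
    (st : 'cV[R]_n * R * 'cV[R]_n) : 'cV[R]_n * R * 'cV[R]_n :=
  let: (qprev, beta, q) := st in
  let u := A *m q - beta *: qprev in
  let r := u - dotv q u *: q in
  (q, norm2 r, (norm2 r)^-1 *: r).

Definition lanczos_state (R : realType) (n : nat) (A : 'M[R]_n)
    (b : 'cV[R]_n) (j : nat) : 'cV[R]_n * R * 'cV[R]_n :=
  iter j (lanczos_step A) (0, 0, (norm2 b)^-1 *: b).

Definition lanczos_vec (R : realType) (n : nat) (A : 'M[R]_n)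
    (b : 'cV[R]_n) (j : nat) : 'cV[R]_n := (lanczos_state A b j).2.

Definition lanczos_Q (R : realType) (n : nat) (A : 'M[R]_n)
    (b : 'cV[R]_n) (K : nat) : 'M[R]_(n, K) :=
  \matrix_(i < n, j < K) lanczos_vec A b j i 0.

Definition lanczos_T (R : realType) (n : nat) (A : 'M[R]_n)
    (b : 'cV[R]_n) (K : nat) : 'M[R]_K :=
  (lanczos_Q A b K)^T *m A *m lanczos_Q A b K.

Definition eigendecomposition (R : realType) (K : nat)
    (T V : 'M[R]_K) (lambda : 'I_K -> R) : Prop :=
  V^T *m V = 1%:M /\ T = V *m diag_mx (\row_i lambda i) *m V^T.

Definition node_mx (R : realType) (N : nat) (x : 'I_N -> R) : 'M[R]_N :=
  diag_mx (\row_i x i).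

Definition weight_vec (R : realType) (N : nat) (w : 'I_N -> R) : 'cV[R]_N :=
  \col_i Num.sqrt (w i).

(* An eigendecomposition is not unique, so the reduced rule is a relation
   rather than a function of (x, w). *)
Definition lanczos_rule (R : realType) (N K : nat) (x w : 'I_N -> R)
    (lambda s : 'I_K -> R) : Prop :=
  let A := node_mx x in
  let b := weight_vec w in
  exists V : 'M[R]_K,
    eigendecomposition (lanczos_T A b K) V lambda /\
    forall i, s i = (((lanczos_Q A b K *m V)^T *m b) i 0) ^+ 2.

Definition quadrature (R : realType) (n : nat) (x w : 'I_n -> R)
    (f : {poly R}) : R :=
  \sum_(i < n) f.[x i] * w i.

Definition jacobi_weight (R : realType) (alpha r : R) : R :=
  (1 - r ^+ 2) `^ (alpha / 2).

Definition weighted_integral (R : realType) (alpha : R) (f : {poly R}) : R :=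
  \int[lebesgue_measure]_(r in `[0, 1]%classic) (f.[r] * jacobi_weight alpha r).

(* Main.v *)
Require Import Defs.
From HB Require Import structures.
From mathcomp Require Import all_boot all_order all_algebra.
From mathcomp Require Import all_classical all_reals all_analysis.
From mathcomp Require Import ring zify.

Set Implicit Arguments.
Unset Strict Implicit.
Unset Printing Implicit Defensive.

Import Order.TTheory GRing.Theory Num.Theory.

Local Open Scope ring_scope.

(** The reduced rule is a Gauss rule for the discrete measure with mass [w i]
    at [x i].  With [A = diag x] and [b] the vector of square roots of the
    weights, the moments of that measure are [b^T A^m b]; those of the reduced
    rule are [c^T T^m c], where [c = Q^T b] and [T = Q^T A Q], because an
    orthogonal diagonalization of [T] only changes coordinates
    ([moment_orthogonal_change]).  So it suffices to compare the moments of
    order [m < 2 K].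

    Suppose that the columns of [Q] are orthonormal and span the Krylov space
    of order [K].  Then [Q Q^T] fixes [A^k b] for [k < K], and inductively
    [A^k b = Q T^k c] for those [k] ([krylov_compression]).  Splitting
    [m = 2 h] or [m = 2 h + 1] with [h < K] and moving one [A^h] to the
    left argument by symmetry gives [b^T A^m b = c^T T^m c]
    ([compressed_moment]): the one extra factor [A] between the two halves
    is absorbed by [Q^T A Q = T], which explains the degree [2 K - 1].

    The short Lanczos recurrence does produce such a [Q].  It
    orthogonalizes [A q_j] only against [q_j] and [q_(j-1)]; the symmetry of
    [A] makes it orthogonal to the earlier vectors ([lanczos_orthogonal]).
    It does not break down before step [N], because [q_j = p(A) b] with [p]
    of degree exactly [j], and a nonzero polynomial of degree less than [N]
    cannot vanish at the [N] distinct nodes, whose weights are positive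
    ([lanczos_vec_neq0]). *)

(** * The Euclidean inner product *)

Section InnerProduct.
Variables (R : realType) (n : nat).
Implicit Types (u v w : 'cV[R]_n) (a : R).

Lemma dotvE u v : dotv u v = \sum_i u i 0 * v i 0.
Proof. by rewrite /dotv mxE; apply: eq_bigr => i _; rewrite mxE. Qed.

Lemma dotvC u v : dotv u v = dotv v u.
Proof. by rewrite !dotvE; apply: eq_bigr => i _; rewrite mulrC. Qed.

Lemma dotvDr u v w : dotv u (v + w) = dotv u v + dotv u w.
Proof. by rewrite /dotv mulmxDr mxE. Qed.

Lemma dotvBr u v w : dotv u (v - w) = dotv u v - dotv u w.
Proof. by rewrite /dotv mulmxBr !mxE. Qed.

Lemma dotvZr a u v : dotv u (a *: v) = a * dotv u v.
Proof. by rewrite /dotv -scalemxAr mxE. Qed.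

Lemma dotv0r u : dotv u 0 = 0.
Proof. by rewrite /dotv mulmx0 mxE. Qed.

Lemma dotv_ge0 u : 0 <= dotv u u.
Proof. by rewrite dotvE sumr_ge0 // => i _; rewrite -expr2 sqr_ge0. Qed.

Lemma dotv_eq0 u : (dotv u u == 0) = (u == 0).
Proof.
apply/eqP/eqP => [|->]; last exact: dotv0r.
rewrite dotvE => /psumr_eq0P u0; apply/matrixP => i j; rewrite ord1 mxE.
by apply/eqP; rewrite -sqrf_eq0 expr2 u0 // => k _; rewrite -expr2 sqr_ge0.
Qed.

Lemma norm2_eq0 u : (norm2 u == 0) = (u == 0).
Proof. by rewrite /norm2 sqrtr_eq0 -dotv_eq0 eq_le dotv_ge0 andbT. Qed.

Lemma norm2_sqr u : norm2 u ^+ 2 = dotv u u.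
Proof. by rewrite sqr_sqrtr // dotv_ge0. Qed.

Lemma dotv_normalized u :
  (norm2 u)^-1 *: u != 0 ->
  dotv ((norm2 u)^-1 *: u) ((norm2 u)^-1 *: u) = 1.
Proof.
rewrite scaler_eq0 invr_eq0 norm2_eq0 orbb => u_neq0.
have nu_neq0 : norm2 u != 0 by rewrite norm2_eq0.
by rewrite dotvZr dotvC dotvZr -norm2_sqr; field.
Qed.

Lemma norm2_normalize u : norm2 u *: ((norm2 u)^-1 *: u) = u.
Proof.
have [->|u_neq0] := eqVneq u 0; first by rewrite !scaler0.
by rewrite scalerA divff ?scale1r // norm2_eq0.
Qed.

End InnerProduct.

Lemma dotv_mulmx (R : realType) (m n : nat) (A : 'M[R]_(m, n))
    (u : 'cV[R]_m) (v : 'cV[R]_n) :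
  dotv u (A *m v) = dotv (A^T *m u) v.
Proof. by rewrite /dotv trmx_mul trmxK mulmxA. Qed.

Lemma dotv_sym_mulmx (R : realType) (n : nat) (A : 'M[R]_n)
    (u v : 'cV[R]_n) :
  A^T = A -> dotv u (A *m v) = dotv (A *m u) v.
Proof. by move=> symA; rewrite dotv_mulmx symA. Qed.

(** * The Lanczos recurrence *)

Section Lanczos.
Variables (R : realType) (n : nat) (A : 'M[R]_n) (b : 'cV[R]_n).

Local Notation q := (lanczos_vec A b).

Definition lanczos_prev (j : nat) : 'cV[R]_n := (lanczos_state A b j).1.1.

(** The off-diagonal entry of [T] coupling [q_(j-1)] and [q_j]; it is [0] for
    [j = 0]. *)
Definition lanczos_beta (j : nat) : R := (lanczos_state A b j).1.2.

Local Notation qprev := lanczos_prev.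
Local Notation beta := lanczos_beta.

Definition lanczos_diag (j : nat) : R :=
  dotv (q j) (A *m q j - beta j *: qprev j).

Definition lanczos_residual (j : nat) : 'cV[R]_n :=
  A *m q j - beta j *: qprev j - lanczos_diag j *: q j.

Local Notation resid := lanczos_residual.

Lemma lanczos_stateS j :
  lanczos_state A b j.+1 =
  (q j, norm2 (resid j), (norm2 (resid j))^-1 *: resid j).
Proof.
rewrite /lanczos_state iterS -/(lanczos_state A b j) /resid /lanczos_diag.
rewrite /qprev /beta /lanczos_vec.
by case: (lanczos_state A b j) => [[p c] v].
Qed.

Lemma lanczos_prevS j : qprev j.+1 = q j.
Proof. by rewrite /qprev lanczos_stateS. Qed.

Lemma lanczos_betaS j : beta j.+1 = norm2 (resid j).
Proof. by rewrite /beta lanczos_stateS. Qed.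

Lemma lanczos_vecS j : q j.+1 = (norm2 (resid j))^-1 *: resid j.
Proof. by rewrite {1}/lanczos_vec lanczos_stateS. Qed.

(** This is [residual = beta_(j+1) q_(j+1)] rearranged.  At a breakdown the
    residual and [beta_(j+1)] are both zero, so the equation survives. *)
Lemma lanczos_three_term j :
  A *m q j =
  beta j *: qprev j + lanczos_diag j *: q j + beta j.+1 *: q j.+1.
Proof.
rewrite lanczos_betaS lanczos_vecS norm2_normalize /resid.
by rewrite addrC -[_ - _ - _]addrA -opprD subrK.
Qed.

Lemma dotv_lanczos_vec j : q j != 0 -> dotv (q j) (q j) = 1.
Proof. by case: j => [|j]; rewrite ?lanczos_vecS; apply: dotv_normalized. Qed.

Hypothesis symA : A^T = A.

(** For [i < j], symmetry turns [<q_i, A q_j>] into [<A q_i, q_j>], where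
    [A q_i] only involves vectors up to [q_(i+1)].  This vanishes by induction
    unless [i + 1 = j], and then it equals the coefficient [beta j] that the
    recurrence subtracts. *)
Lemma lanczos_orthogonal K :
  (forall j, (j < K)%N -> q j != 0) ->
  forall i j, (i < j)%N -> (j < K)%N -> dotv (q i) (q j) = 0.
Proof.
move=> q_neq0 i j; elim/ltn_ind: j i => -[//|j] IHj i lt_i_j1 lt_j1_K.
have lt_j_K : (j < K)%N by exact: ltnW.
have orth k : (k < j)%N -> dotv (q k) (q j) = 0.
  by move=> lt_k_j; apply: IHj.
have norm1 k : (k < K)%N -> dotv (q k) (q k) = 1.
  by move=> lt_k_K; apply/dotv_lanczos_vec/q_neq0.
rewrite lanczos_vecS dotvZr; apply/eqP; rewrite mulf_eq0; apply/orP; right.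
apply/eqP; move: lt_i_j1; rewrite ltnS leq_eqVlt => /predU1P[->|lt_i_j].
  by rewrite /resid dotvBr dotvZr norm1 // mulr1 subrr.
have prev_orth : dotv (qprev i) (q j) = 0.
  case: (i) lt_i_j => [_|k lt_k_j]; first by rewrite dotvC dotv0r.
  by rewrite lanczos_prevS orth // ltnW.
rewrite /resid !dotvBr !dotvZr orth // mulr0 subr0 dotv_sym_mulmx //.
rewrite lanczos_three_term dotvC !dotvDr !dotvZr.
rewrite ![dotv (q j) _]dotvC prev_orth orth // !mulr0 !add0r.
have lt_i_K := ltn_trans lt_i_j lt_j_K.
move: lt_i_j lt_j_K; rewrite leq_eqVlt => /predU1P[<- lt_i1_K|lt_i1_j lt_j_K].
  by rewrite lanczos_prevS !norm1 // mulr1 subrr.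
rewrite orth // mulr0 sub0r.
case: (j) lt_i1_j lt_j_K IHj => [//|k] lt_i_k lt_k_K IHk.
by rewrite lanczos_prevS IHk ?mulr0 ?oppr0 // ltnW.
Qed.

End Lanczos.

Section Krylov.
Variables (R : realType) (n : nat) (A : 'M[R]_n) (b : 'cV[R]_n) (K : nat).

Local Notation q := (lanczos_vec A b).
Local Notation Q := (lanczos_Q A b K).
Local Notation T := (lanczos_T A b K).

Hypothesis symA : A^T = A.
Hypothesis q_neq0 : forall j, (j < K)%N -> q j != 0.

Lemma lanczos_Q_delta (j : 'I_K) : Q *m delta_mx j 0 = q j.
Proof. by rewrite -colE; apply/matrixP => i k; rewrite !mxE ord1. Qed.

Lemma lanczos_Q_orthonormal : Q^T *m Q = 1%:M.
Proof.
apply/matrixP => i j; rewrite !mxE.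
have -> : \sum_k (Q^T i k * Q k j) = dotv (q i) (q j).
  by rewrite dotvE; apply: eq_bigr => k _; rewrite !mxE.
rewrite -val_eqE /=; case: ltngtP => [lt_ij|lt_ji|->].
- exact: (lanczos_orthogonal symA q_neq0).
- by rewrite dotvC; apply: (lanczos_orthogonal symA q_neq0).
- by rewrite dotv_lanczos_vec ?q_neq0.
Qed.

(** Each factor [A] raises the largest index that occurs by one, so
    [A^k q_j] stays in the range of [Q] as long as [j + k < K].  The
    statement is for every [j] because the recurrence feeds the induction on
    [k] with the neighbours of [q_j]. *)
Lemma lanczos_range_power k j :
  (j + k < K)%N -> Q *m Q^T *m (A ^+ k *m q j) = A ^+ k *m q j.
Proof.
elim: k j => [|k IHk] j ltK.
  rewrite addn0 in ltK; rewrite expr0 mul1mx -(lanczos_Q_delta (Ordinal ltK)).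
  by rewrite mulmxA -[_ *m Q]mulmxA lanczos_Q_orthonormal mulmx1.
have -> : A ^+ k.+1 *m q j = A ^+ k *m (A *m q j) by rewrite exprSr mulmxA.
rewrite lanczos_three_term !mulmxDr -!scalemxAr.
rewrite (IHk j) 1?(IHk j.+1); [|lia..].
congr (_ *: _ + _ + _).
case: j ltK => [|j] ltK; first by rewrite /lanczos_prev /= !mulmx0.
by rewrite lanczos_prevS IHk //; lia.
Qed.

Lemma krylov_range k : (k < K)%N -> Q *m Q^T *m (A ^+ k *m b) = A ^+ k *m b.
Proof.
move=> ltK.
have /(congr1 ( *:%R (norm2 b))) := lanczos_range_power (j := 0) ltK.
by rewrite !scalemxAr norm2_normalize.
Qed.

(** As [A^(k+1) b] is fixed by [Q Q^T], it equals
    [Q (Q^T A Q) (T^k Q^T b)] once [A^k b] has been compressed. *)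
Lemma krylov_compression k :
  (k < K)%N -> A ^+ k *m b = Q *m (T ^+ k *m (Q^T *m b)).
Proof.
elim: k => [|k IHk] ltK.
  by have := krylov_range ltK; rewrite !expr0 !mul1mx mulmxA.
rewrite -krylov_range //.
have -> : A ^+ k.+1 *m b = A *m (A ^+ k *m b) by rewrite exprS mulmxA.
by rewrite IHk ?(ltnW ltK) // exprS /lanczos_T !mulmxA.
Qed.

Lemma lanczos_T_sym : T^T = T.
Proof. by rewrite /lanczos_T !trmx_mul trmxK symA mulmxA. Qed.

Lemma dotv_pow_split (m : nat) (B : 'M[R]_m) (u v : 'cV[R]_m) k l :
  B^T = B -> dotv u (B ^+ (k + l) *m v) = dotv (B ^+ k *m u) (B ^+ l *m v).
Proof.
move=> symB; elim: k u => [|k IHk] u; first by rewrite mul1mx.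
have -> : B ^+ (k.+1 + l) *m v = B *m (B ^+ (k + l) *m v).
  by rewrite addSn exprS mulmxA.
by rewrite dotv_sym_mulmx // IHk exprSr mulmxA.
Qed.

(** Write [m = h + (e + h)] with [h < K] and [e <= 1].  By symmetry the moment
    is [<u, A^e u>] with [u = A^h b], which lies in the range of [Q]; in the
    coordinates given by the columns of [Q] this form is [<v, T^e v>] with
    [v = T^h (Q^T b)]. *)
Lemma compressed_moment m :
  (m < 2 * K)%N ->
  dotv b (A ^+ m *m b) = dotv (Q^T *m b) (T ^+ m *m (Q^T *m b)).
Proof.
move=> ltm.
have [h lthK [e ->]] :
    exists2 h, (h < K)%N & exists e : bool, m = (h + (e + h))%N.
  by exists m./2; [lia | exists (odd m); lia].
have pow_split p (B : 'M[R]_p) (v : 'cV_p) :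
    B ^+ (e + h) *m v = B ^+ e *m (B ^+ h *m v).
  by rewrite exprD mulmxA.
rewrite dotv_pow_split // [RHS]dotv_pow_split ?lanczos_T_sym // !pow_split.
rewrite !krylov_compression //.
set u := T ^+ _ *m (Q^T *m b).
case: e pow_split => _; last first.
  by rewrite !expr0 !mul1mx dotv_mulmx mulmxA lanczos_Q_orthonormal mul1mx.
by rewrite !expr1 -[Q in LHS]trmxK -dotv_mulmx trmxK /lanczos_T !mulmxA.
Qed.

End Krylov.

(** * Absence of breakdown *)

Section Breakdown.
Variables (R : realType) (n : nat) (x : 'I_n -> R) (b : 'cV[R]_n).

Local Notation A := (node_mx x).
Local Notation q := (lanczos_vec A b).

(** The vector [p(A) b]; since [A] is diagonal it can be written entrywise. *)
Definition node_apply (p : {poly R}) : 'cV[R]_n := \col_i (p.[x i] * b i 0).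

Lemma node_mx_apply (p : {poly R}) :
  A *m node_apply p = node_apply ('X * p).
Proof.
apply/matrixP => i j.
by rewrite /node_mx mul_diag_mx !mxE hornerM hornerX mulrA.
Qed.

Lemma node_applyZ a p : a *: node_apply p = node_apply (a *: p).
Proof. by apply/matrixP => i j; rewrite !mxE hornerZ mulrA. Qed.

Lemma node_applyB p r : node_apply p - node_apply r = node_apply (p - r).
Proof. by apply/matrixP => i j; rewrite !mxE hornerD hornerN mulrBl. Qed.

Hypothesis inj_x : injective x.
Hypothesis b_neq0 : forall i, b i 0 != 0.

Lemma node_apply_neq0 (p : {poly R}) :
  p != 0 -> (size p <= n)%N -> node_apply p != 0.
Proof.
move=> p_neq0 szp; apply/eqP => p0.
have uniq_x : uniq (map x (enum 'I_n)) by rewrite map_inj_uniq ?enum_uniq.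
have roots : all (root p) (map x (enum 'I_n)).
  apply/allP => _ /mapP[i _ ->]; apply/eqP/(mulIf (b_neq0 i)).
  by move/matrixP/(_ i 0): p0; rewrite !mxE mul0r.
have := max_poly_roots p_neq0 roots uniq_x.
by rewrite size_map size_enum_ord ltnNge szp.
Qed.

(** The residual at step [j] is [p(A) b] with [p] of degree [j + 1]: the
    leading term comes from [A q_j] alone.  The polynomial of [q_(j-1)] is
    carried along only to bound its degree. *)
Lemma lanczos_vec_poly j : (j < n)%N ->
  exists p r : {poly R},
    [/\ size p = j.+1, q j = node_apply p,
        (size r <= j)%N & lanczos_prev A b j = node_apply r].
Proof.
elim: j => [|j IHj] lt_jn.
  exists (norm2 b)^-1%:P, 0; split.
  - rewrite size_polyC invr_eq0 norm2_eq0; case: eqP => // b0.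
    by have := b_neq0 (Ordinal lt_jn); rewrite b0 mxE eqxx.
  - by apply/matrixP => i k; rewrite ord1 !mxE hornerC.
  - by rewrite size_poly0.
  - by apply/matrixP => i k; rewrite !mxE horner0 mul0r.
have [p [r [szp qE szr prevE]]] := IHj (ltnW lt_jn).
pose t : {poly R} :=
  'X * p - lanczos_beta A b j *: r - lanczos_diag A b j *: p.
have residE : lanczos_residual A b j = node_apply t.
  by rewrite /lanczos_residual prevE qE node_mx_apply !node_applyZ !node_applyB.
have szXp : size ('X * p) = j.+2.
  by rewrite mulrC size_mulX ?szp // -size_poly_eq0 szp.
have szt : size t = j.+2.
  rewrite /t -addrA -opprD size_polyDl szXp // size_polyN.
  rewrite (leq_ltn_trans (size_polyD _ _)) // gtn_max.
  by rewrite !(leq_ltn_trans (size_scale_leq _ _)) ?szp // ltnS ltnW ?ltnS.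
have t_neq0 : t != 0 by rewrite -size_poly_eq0 szt.
have resid_neq0 : norm2 (lanczos_residual A b j) != 0.
  by rewrite norm2_eq0 residE node_apply_neq0 ?szt.
exists ((norm2 (lanczos_residual A b j))^-1 *: t), p; split.
- by rewrite size_scale ?invr_eq0.
- by rewrite lanczos_vecS -node_applyZ -residE.
- by rewrite szp.
- by rewrite lanczos_prevS.
Qed.

Lemma lanczos_vec_neq0 j : (j < n)%N -> q j != 0.
Proof.
move=> lt_jn; have [p [_ [szp -> _ _]]] := lanczos_vec_poly lt_jn.
by rewrite node_apply_neq0 ?szp // -size_poly_eq0 szp.
Qed.

End Breakdown.

(** * Quadrature sums as moments *)

Lemma node_mx_pow (R : realType) (n : nat) (x : 'I_n -> R) m :
  node_mx x ^+ m = node_mx (fun i => x i ^+ m).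
Proof.
elim: m => [|m IHm].
  by apply/matrixP => i j; rewrite expr0 !mxE expr0.
rewrite exprS IHm [_ * _]mulmx_diag; congr diag_mx.
by apply/rowP => i; rewrite !mxE exprS.
Qed.

Lemma quadrature_Xn (R : realType) (n : nat) (x w : 'I_n -> R)
    (b : 'cV[R]_n) m :
  (forall i, w i = b i 0 ^+ 2) ->
  quadrature x w 'X^m = dotv b (node_mx x ^+ m *m b).
Proof.
move=> wE; rewrite /quadrature dotvE node_mx_pow; apply: eq_bigr => i _.
by rewrite /node_mx mul_diag_mx !mxE hornerXn wE; ring.
Qed.

Lemma quadrature_sum_Xn (R : realType) (n : nat) (x w : 'I_n -> R)
    (f : {poly R}) m :
  (size f <= m)%N ->
  quadrature x w f = \sum_(k < m) f`_k * quadrature x w 'X^k.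
Proof.
move=> szf; rewrite /quadrature.
under [RHS]eq_bigr => k _ do rewrite mulr_sumr.
rewrite exchange_big /=; apply: eq_bigr => i _.
rewrite (horner_coef_wide _ szf) mulr_suml.
by apply: eq_bigr => k _; rewrite hornerXn mulrA.
Qed.

Lemma moment_orthogonal_change (R : realType) (K : nat) (T V : 'M[R]_K)
    (lambda : 'I_K -> R) (c : 'cV[R]_K) m :
  eigendecomposition T V lambda ->
  dotv c (T ^+ m *m c) =
  dotv (V^T *m c) (node_mx lambda ^+ m *m (V^T *m c)).
Proof.
case=> orthV TE.
have -> : T ^+ m = V *m node_mx lambda ^+ m *m V^T.
  elim: m => [|m IHm]; first by rewrite !expr0 mulmx1 (mulmx1C orthV).
  rewrite !exprS IHm {1}TE -[_ * _]/(_ *m _) !mulmxA.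
  by rewrite -[_ *m V^T *m V]mulmxA orthV mulmx1.
by rewrite -!mulmxA dotv_mulmx.
Qed.

(** Exactness on degree below [2 K] is linear in [f], so it reduces to the
    moments.  Those of both rules are quadratic forms: the first in the
    vector of square roots of [w], the second in [(Q V)^T b], whose squared
    entries are the weights [s]. *)
Lemma lanczos_rule_exact (R : realType) (K N : nat) (x w : 'I_N -> R)
    (lambda s : 'I_K -> R) (f : {poly R}) :
  (K <= N)%N -> injective x -> (forall i, 0 < w i) ->
  lanczos_rule x w lambda s -> (size f <= 2 * K)%N ->
  quadrature lambda s f = quadrature x w f.
Proof.
move=> leKN inj_x w_gt0 [V [eigV sE]] szf.
rewrite !(quadrature_sum_Xn _ _ szf); apply: eq_bigr => k _; congr (_ * _).
have bE i : w i = weight_vec w i 0 ^+ 2 by rewrite mxE sqr_sqrtr // ltW.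
have b_neq0 i : weight_vec w i 0 != 0.
  by rewrite mxE gt_eqF // sqrtr_gt0.
rewrite (quadrature_Xn _ _ bE) (quadrature_Xn _ _ sE) trmx_mul -!mulmxA.
rewrite -(moment_orthogonal_change _ _ eigV) -compressed_moment //.
- exact: tr_diag_mx.
- by move=> j ltjK; apply: lanczos_vec_neq0 => //; exact: leq_trans leKN.
Qed.

Theorem theorem7 (R : realType) (alpha : R) (K N : nat) (x w : 'I_N -> R)
    (lambda s : 'I_K -> R) (eps : R)
    (halpha : 0 < alpha < 2)
    (hKN : (1 <= K < N)%N)
    (hx : forall i, 0 <= x i < 1)
    (hinj : injective x)
    (hw : forall i, w i = jacobi_weight alpha (x i) / N%:R)
    (hrule : lanczos_rule x w lambda s)
    (heps : 0 <= eps)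
    (f : {poly R})
    (hdeg : (size f <= 2 * K)%N)
    (hf : `|weighted_integral alpha f - quadrature x w f| <= eps) :
  quadrature lambda s f = quadrature x w f /\
  `|weighted_integral alpha f - quadrature lambda s f| <= eps.
Proof.
have [_ ltKN] := andP hKN.
have w_gt0 i : 0 < w i.
  have [x_ge0 x_lt1] := andP (hx i).
  rewrite hw divr_gt0 ?ltr0n ?(leq_ltn_trans _ ltKN) // powR_gt0 //.
  by rewrite subr_gt0 expr_lt1.
have -> : quadrature lambda s f = quadrature x w f.
  exact: lanczos_rule_exact (ltnW ltKN) hinj w_gt0 hrule hdeg.
by [].
Qed.
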